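(* Let $R$ be a ring, $M$ a right $R$-module and $S=\mathrm{End}_R(M)$. If $M$ is dual Rickart, then $M$ is dual $\pi$-Rickart. The converse holds if $S$ is a reduced ring; that is, if $S$ is reduced and $M$ is dual $\pi$-Rickart, then $M$ is dual Rickart.
   Context: Rings are associative with identity and modules are unitary right modules. For a right $R$-module $M$ with $S=\mathrm{End}_R(M)$: $M$ is dual Rickart if for every $f\in S$ there exists $e^2=e\in S$ with $\mathrm{Im} f=eM$; $M$ is dual $\pi$-Rickart if for every $f\in S$ there exist $e^2=e\in S$ and a positive integer $n$ such that $\mathrm{Im} f^n=eM$. A ring is reduced if it has no nonzero nilpotent elements. *)

(* Defs.v *)
From HB Require Import structures.
From mathcomp Require Import all_boot all_algebra.
From mathcomp Require Import boolp classical_sets.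

Set Implicit Arguments.
Unset Strict Implicit.
Unset Printing Implicit Defensive.

Import GRing.Theory.
Local Open Scope ring_scope.
Local Open Scope classical_set_scope.

(* Right R-modules are left modules over the converse ring: a *: x stands for
   x . a, so that scalerA reads (x . b) . a = x . (b * a), with the product
   b * a taken in R. *)
Notation rmodType R := (lmodType R^c).

(* The endomorphism ring of M, with composition as product. *)
Definition endR (R : pzRingType) (M : rmodType R) : Type := {linear M -> M}.

Section EndomorphismRing.
Variables (R : pzRingType) (M : rmodType R).
Implicit Types f g h : endR M.

HB.instance Definition _ := gen_eqMixin (endR M).
HB.instance Definition _ := gen_choiceMixin (endR M).

Definition endR_zero : endR M := \0 : {linear M -> M}.
Definition endR_opp f : endR M := \- f : {linear M -> M}.
Definition endR_add f g : endR M := f \+ g : {linear M -> M}.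
Definition endR_one : endR M := idfun : {linear M -> M}.
Definition endR_mul f g : endR M := f \o g : {linear M -> M}.

Lemma endR_ext f g : f =1 g -> f = g.
Proof.
case: f g => f [[fB] [fZ]] [g [[gB] [gZ]]] /= /funext fg.
by case: _ / fg in gB gZ *; rewrite (Prop_irrelevance fB gB) (Prop_irrelevance fZ gZ).
Qed.

Fact endR_addA : associative endR_add.
Proof. by move=> f g h; apply: endR_ext => x /=; rewrite addrA. Qed.
Fact endR_addC : commutative endR_add.
Proof. by move=> f g; apply: endR_ext => x /=; rewrite addrC. Qed.
Fact endR_add0 : left_id endR_zero endR_add.
Proof. by move=> f; apply: endR_ext => x /=; rewrite add0r. Qed.
Fact endR_addN : left_inverse endR_zero endR_opp endR_add.
Proof. by move=> f; apply: endR_ext => x /=; rewrite addNr. Qed.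

HB.instance Definition _ := GRing.isZmodule.Build (endR M)
  endR_addA endR_addC endR_add0 endR_addN.

Fact endR_mulA : associative endR_mul.
Proof. by move=> f g h; apply: endR_ext. Qed.
Fact endR_mul1 : left_id endR_one endR_mul.
Proof. by move=> f; apply: endR_ext. Qed.
Fact endR_mulr1 : right_id endR_one endR_mul.
Proof. by move=> f; apply: endR_ext. Qed.
Fact endR_mulDl : left_distributive endR_mul +%R.
Proof. by move=> f g h; apply: endR_ext. Qed.
Fact endR_mulDr : right_distributive endR_mul +%R.
Proof. by move=> f g h; apply: endR_ext => x /=; rewrite linearD. Qed.

HB.instance Definition _ := GRing.Zmodule_isPzRing.Build (endR M)
  endR_mulA endR_mul1 endR_mulr1 endR_mulDl endR_mulDr.

Lemma endR_mulE f g x : (f * g) x = f (g x).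
Proof. by []. Qed.

Lemma endR_oneE x : (1 : endR M) x = x.
Proof. by []. Qed.

End EndomorphismRing.

Definition reduced (A : pzRingType) : Prop :=
  forall x : A, (exists2 n : nat, (0 < n)%N & x ^+ n = 0) -> x = 0.

Definition dual_rickart (R : pzRingType) (M : rmodType R) : Prop :=
  forall f : endR M, exists2 e : endR M, e ^+ 2 = e & range f = range e.

Definition dual_pi_rickart (R : pzRingType) (M : rmodType R) : Prop :=
  forall f : endR M, exists (e : endR M) (n : nat),
    [/\ e ^+ 2 = e, (0 < n)%N & range (f ^+ n) = range e].

(* Main.v *)
(* An idempotent of a reduced ring is central. If Im f^n = eM, then
   (1 - e) f^n = 0, so centrality of e gives ((1 - e) f)^n = 0, whence
   f = e f and Im f is squeezed between Im f^n = eM and eM. *)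
Require Import Defs.
From mathcomp Require Import all_boot all_algebra.
From mathcomp Require Import boolp classical_sets.

Import GRing.Theory.
Local Open Scope ring_scope.
Local Open Scope classical_set_scope.

Lemma reduced_sqr0 (A : pzRingType) (x : A) : reduced A -> x * x = 0 -> x = 0.
Proof. by move=> Ared xx0; apply: Ared; exists 2%N; rewrite ?expr2. Qed.

(** Since [(1 - e) * e = 0 = e * (1 - e)], both Peirce corners [e * x * (1 - e)] and
    [(1 - e) * x * e] square to zero, hence vanish; so [e * x] and [x * e] both equal
    [e * x * e]. *)
Lemma reduced_idem_central (A : pzRingType) (e x : A) :
  reduced A -> e ^+ 2 = e -> GRing.comm e x.
Proof.
rewrite expr2 => Ared ee.
have e1e : (1 - e) * e = 0 by rewrite mulrBl mul1r ee subrr.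
have ee1 : e * (1 - e) = 0 by rewrite mulrBr mulr1 ee subrr.
have ex : e * x * (1 - e) = 0.
  by apply: reduced_sqr0 => //; rewrite !mulrA -(mulrA _ _ e) e1e mulr0 !mul0r.
have xe : (1 - e) * x * e = 0.
  by apply: reduced_sqr0 => //; rewrite !mulrA -(mulrA _ e) ee1 mulr0 !mul0r.
move: ex xe; rewrite mulrBr mulr1 mulrBl mul1r mulrBl.
by move=> /subr0_eq exe /subr0_eq xe; rewrite /GRing.comm exe -xe.
Qed.

Lemma range_exp_sub (R : pzRingType) (M : rmodType R) (f : endR M) (n : nat) :
  (0 < n)%N -> range (f ^+ n) `<=` range f.
Proof. by case: n => // n _ _ [x _ <-]; exists ((f ^+ n) x); rewrite ?exprS. Qed.

(** An idempotent fixes exactly the points of its image. This turns inclusions of images into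
    equations in the endomorphism ring, where reducedness can act. *)
Lemma idem_mul_rangeP (R : pzRingType) (M : rmodType R) (e f : endR M) :
  e ^+ 2 = e -> e * f = f <-> range f `<=` range e.
Proof.
rewrite expr2 => ee; split=> [<- _ [x _ <-]|fe]; first by exists (f x).
apply: endR_ext => x; rewrite endR_mulE.
by have [|y _ <-] := fe (f x); [exists x | rewrite -endR_mulE ee].
Qed.

Theorem proposition2p4 (R : pzRingType) (M : rmodType R) :
  (dual_rickart M -> dual_pi_rickart M) /\
  (reduced (endR M) -> dual_pi_rickart M -> dual_rickart M).
Proof.
split=> [rM f | Sred piM f].
  by have [e ee fe] := rM f; exists e, 1%N; rewrite expr1.
have [e [n [ee n_gt0 fne]]] := piM f; exists e => //.
have efn : e * f ^+ n = f ^+ n by apply/(idem_mul_rangeP _ _ _ _ ee); rewrite fne.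
have cef : GRing.comm (1 - e) f.
  apply/commr_sym/commrB; first exact: commr1.
  exact/commr_sym/reduced_idem_central.
have e1f : (1 - e) * f = 0.
  apply: Sred; exists n => //; rewrite exprMn_comm //.
  (* By commutation the power has split as [(1 - e) ^+ n * f ^+ n]. As [n] is positive, one factor
     [1 - e] can be moved next to [f ^+ n], which it annihilates by [efn]. *)
  by rewrite -(prednK n_gt0) exprSr prednK // -mulrA mulrBl mul1r efn subrr mulr0.
apply/seteqP; split; last by rewrite -fne; exact: range_exp_sub.
apply/(idem_mul_rangeP _ _ _ _ ee).
by apply/esym/subr0_eq; rewrite -e1f mulrBl mul1r.
Qed.
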